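(* Let $\mathscr{X}$ be a pointed Bourn protomodular category with finite coproducts, and let $T=(T,\eta,\mu)$ be a monad on $\mathscr{X}$ whose unit $\eta$ is cartesian. Then $T$ is essentially nullary.
   Context: A category is pointed if it has a zero object $0$. A category with pullbacks is Bourn protomodular if for every morphism $v:B'\to B$ the pullback functor $v^*:\mathrm{Pt}(B)\to\mathrm{Pt}(B')$ reflects isomorphisms, where $\mathrm{Pt}(B)$ is the category of points over $B$: its objects are triples $(A,\alpha,\beta)$ with $\alpha:A\to B$, $\beta:B\to A$, $\alpha\beta=1_B$, and its morphisms are the morphisms of the objects $A$ compatible with the $\alpha$'s and $\beta$'s. A natural transformation is cartesian if all of its naturality squares are pullbacks. A monad $T=(T,\eta,\mu)$ on a category $\mathscr{X}$ with finite coproducts is essentially nullary if for every object $X$ of $\mathscr{X}$ the morphism $[T(!_X),\eta_X]:T(0)+X\to T(X)$ is a strong epimorphism, where $!_X:0\to X$ is the unique morphism from the initial object. A strong epimorphism is an epimorphism that is left orthogonal to all monomorphisms. *)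

(* Defs.v *)
From Stdlib Require Import ProofIrrelevance.

Set Implicit Arguments.
Unset Strict Implicit.

Declare Scope cat_scope.
Delimit Scope cat_scope with cat.
Local Open Scope cat_scope.

Record Category := MkCategory {
  obj :> Type;
  Hom : obj -> obj -> Type;
  idm : forall A : obj, Hom A A;
  comp : forall A B C : obj, Hom B C -> Hom A B -> Hom A C;
  comp_idl : forall (A B : obj) (f : Hom A B), comp (idm B) f = f;
  comp_idr : forall (A B : obj) (f : Hom A B), comp f (idm A) = f;
  comp_assoc : forall (A B C D : obj) (h : Hom C D) (g : Hom B C) (f : Hom A B),
      comp h (comp g f) = comp (comp h g) f
}.

Arguments Hom {c} A B.
Arguments idm {c} A.
Arguments comp {c A B C} g f.

Notation "g ∘ f" := (comp g f) (at level 40, left associativity) : cat_scope.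

Definition is_iso (C : Category) (A B : C) (f : Hom A B) : Prop :=
  exists g : Hom B A, g ∘ f = idm A /\ f ∘ g = idm B.

Definition is_mono (C : Category) (A B : C) (m : Hom A B) : Prop :=
  forall (Z : C) (u v : Hom Z A), m ∘ u = m ∘ v -> u = v.

Definition is_epi (C : Category) (A B : C) (e : Hom A B) : Prop :=
  forall (Z : C) (u v : Hom B Z), u ∘ e = v ∘ e -> u = v.

Definition left_orthogonal (C : Category) (A B U V : C)
    (e : Hom A B) (m : Hom U V) : Prop :=
  forall (u : Hom A U) (v : Hom B V), m ∘ u = v ∘ e ->
  exists! d : Hom B U, d ∘ e = u /\ m ∘ d = v.

Definition is_strong_epi (C : Category) (A B : C) (e : Hom A B) : Prop :=
  is_epi e /\
  forall (U V : C) (m : Hom U V), is_mono m -> left_orthogonal e m.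

Record Functor (C D : Category) := MkFunctor {
  fobj :> C -> D;
  fmap : forall A B : C, Hom A B -> Hom (fobj A) (fobj B);
  fmap_id : forall A : C, fmap (idm A) = idm (fobj A);
  fmap_comp : forall (A B E : C) (g : Hom B E) (f : Hom A B),
      fmap (g ∘ f) = fmap g ∘ fmap f
}.

Arguments fmap {C D} _ {A B} _.

Definition reflects_isos (C D : Category) (F : Functor C D) : Prop :=
  forall (A B : C) (f : Hom A B), is_iso (fmap F f) -> is_iso f.

Definition functor_id (C : Category) : Functor C C :=
  @MkFunctor C C (fun A => A) (fun A B f => f)
    (fun A => eq_refl) (fun A B E g f => eq_refl).

Definition functor_comp (C D E : Category) (G : Functor D E) (F : Functor C D) :
  Functor C E.
Proof.
refine (@MkFunctor C E (fun A => G (F A)) (fun A B f => fmap G (fmap F f)) _ _).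
- intros A; rewrite fmap_id; apply fmap_id.
- intros A B K g f; rewrite fmap_comp; apply fmap_comp.
Defined.

Record NatTrans (C D : Category) (F G : Functor C D) := MkNatTrans {
  component :> forall A : C, Hom (F A) (G A);
  naturality : forall (A B : C) (f : Hom A B),
      component B ∘ fmap F f = fmap G f ∘ component A
}.

Definition is_pullback (C : Category) (A B D P : C)
    (f : Hom A D) (g : Hom B D) (p : Hom P A) (q : Hom P B) : Prop :=
  f ∘ p = g ∘ q /\
  forall (Z : C) (u : Hom Z A) (v : Hom Z B), f ∘ u = g ∘ v ->
  exists! h : Hom Z P, p ∘ h = u /\ q ∘ h = v.

Record Pullback (C : Category) (A B D : C) (f : Hom A D) (g : Hom B D) :=
  MkPullback {
  apex : C;
  pb1 : Hom apex A;
  pb2 : Hom apex B;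
  pb_comm : f ∘ pb1 = g ∘ pb2;
  pb_lift : forall (Z : C) (u : Hom Z A) (v : Hom Z B),
      f ∘ u = g ∘ v -> Hom Z apex;
  pb_lift1 : forall (Z : C) (u : Hom Z A) (v : Hom Z B) (e : f ∘ u = g ∘ v),
      pb1 ∘ pb_lift e = u;
  pb_lift2 : forall (Z : C) (u : Hom Z A) (v : Hom Z B) (e : f ∘ u = g ∘ v),
      pb2 ∘ pb_lift e = v;
  pb_unique : forall (Z : C) (h k : Hom Z apex),
      pb1 ∘ h = pb1 ∘ k -> pb2 ∘ h = pb2 ∘ k -> h = k
}.

Lemma Pullback_is_pullback (C : Category) (A B D : C) (f : Hom A D) (g : Hom B D)
    (P : Pullback f g) : is_pullback f g (pb1 P) (pb2 P).
Proof.
split; [apply pb_comm|]. intros Z u v e. exists (pb_lift P e). split.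
- split; [apply pb_lift1 | apply pb_lift2].
- intros h [h1 h2]. apply (pb_unique (p := P)).
  + rewrite pb_lift1; congruence.
  + rewrite pb_lift2; congruence.
Qed.

Definition Pullbacks (C : Category) : Type :=
  forall (A B D : C) (f : Hom A D) (g : Hom B D), Pullback f g.

Definition cartesian (C D : Category) (F G : Functor C D) (t : NatTrans F G) :
  Prop :=
  forall (A B : C) (f : Hom A B),
    is_pullback (t B) (fmap G f) (fmap F f) (t A).

Record Point (C : Category) (B : C) := MkPoint {
  pt_obj : C;
  pt_proj : Hom pt_obj B;
  pt_sect : Hom B pt_obj;
  pt_split : pt_proj ∘ pt_sect = idm B
}.

Record PointHom (C : Category) (B : C) (P Q : Point B) := MkPointHom {
  pt_map : Hom (pt_obj P) (pt_obj Q);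
  pt_map_proj : pt_proj Q ∘ pt_map = pt_proj P;
  pt_map_sect : pt_map ∘ pt_sect P = pt_sect Q
}.

Lemma PointHom_eq (C : Category) (B : C) (P Q : Point B) (f g : PointHom P Q) :
  pt_map f = pt_map g -> f = g.
Proof.
destruct f as [f f1 f2], g as [g g1 g2]; simpl; intros e; subst g.
f_equal; apply proof_irrelevance.
Qed.

Definition point_id (C : Category) (B : C) (P : Point B) : PointHom P P :=
  MkPointHom (comp_idr (pt_proj P)) (comp_idl (pt_sect P)).

Definition point_comp (C : Category) (B : C) (P Q R : Point B)
  (g : PointHom Q R) (f : PointHom P Q) : PointHom P R.
Proof.
refine (@MkPointHom C B P R (pt_map g ∘ pt_map f) _ _).
- rewrite comp_assoc, pt_map_proj; apply pt_map_proj.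
- rewrite <- comp_assoc, pt_map_sect; apply pt_map_sect.
Defined.

Definition Pt (C : Category) (B : C) : Category.
Proof.
refine (@MkCategory (Point B) (@PointHom C B) (@point_id C B)
          (@point_comp C B) _ _ _).
- intros P Q f; apply PointHom_eq, comp_idl.
- intros P Q f; apply PointHom_eq, comp_idr.
- intros P Q R S h g f; apply PointHom_eq, comp_assoc.
Defined.

Section PullbackFunctor.
Variables (C : Category) (PB : Pullbacks C) (B' B : C) (v : Hom B' B).

Lemma pb_point_sect_comm (P : Point B) :
  v ∘ idm B' = pt_proj P ∘ (pt_sect P ∘ v).
Proof. now rewrite comp_assoc, pt_split, comp_idl, comp_idr. Qed.

(** The pullback [B' x_B A] of [alpha : A -> B] along [v], with its projection
    to [B'] and the section [<1, beta v>]. *)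
Definition pb_point (P : Point B) : Point B' :=
  MkPoint (pb_lift1 (PB v (pt_proj P)) (pb_point_sect_comm P)).

Lemma pb_point_map_comm (P Q : Point B) (f : PointHom P Q) :
  v ∘ pb1 (PB v (pt_proj P))
  = pt_proj Q ∘ (pt_map f ∘ pb2 (PB v (pt_proj P))).
Proof. rewrite comp_assoc, pt_map_proj; apply pb_comm. Qed.

Definition pb_point_map (P Q : Point B) (f : PointHom P Q) :
  PointHom (pb_point P) (pb_point Q).
Proof.
refine (@MkPointHom C B' (pb_point P) (pb_point Q)
          (pb_lift (PB v (pt_proj Q)) (pb_point_map_comm f)) _ _).
- apply pb_lift1.
- simpl; apply pb_unique; rewrite comp_assoc.
  + now rewrite !pb_lift1.
  + rewrite !pb_lift2, <- comp_assoc, pb_lift2, comp_assoc.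
    now rewrite pt_map_sect.
Defined.

Definition pullback_functor : Functor (Pt B) (Pt B').
Proof.
refine (@MkFunctor (Pt B) (Pt B') pb_point pb_point_map _ _).
- intros P; apply PointHom_eq; simpl; apply pb_unique.
  + now rewrite pb_lift1, comp_idr.
  + now rewrite pb_lift2, comp_idr, comp_idl.
- intros P Q R g f; apply PointHom_eq; simpl; apply pb_unique;
    rewrite (comp_assoc (pb1 _)) || rewrite (comp_assoc (pb2 _)).
  + now rewrite !pb_lift1.
  + now rewrite !pb_lift2, <- !comp_assoc, pb_lift2.
Defined.

End PullbackFunctor.

Definition protomodular (C : Category) (PB : Pullbacks C) : Prop :=
  forall (B' B : C) (v : Hom B' B), reflects_isos (pullback_functor PB v).

Definition is_initial (C : Category) (I : C) : Prop :=
  forall A : C, exists! f : Hom I A, True.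

Definition is_terminal (C : Category) (I : C) : Prop :=
  forall A : C, exists! f : Hom A I, True.

Definition pointed (C : Category) : Prop :=
  exists Z : C, is_initial Z /\ is_terminal Z.

(** Chosen finite coproducts, as a chosen initial object and chosen binary
    coproducts. *)
Record FiniteCoproducts (C : Category) := MkFiniteCoproducts {
  initial : C;
  from_initial : forall A : C, Hom initial A;
  from_initial_unique : forall (A : C) (f : Hom initial A), f = from_initial A;
  coprod : C -> C -> C;
  inj1 : forall A B : C, Hom A (coprod A B);
  inj2 : forall A B : C, Hom B (coprod A B);
  copair : forall A B D : C, Hom A D -> Hom B D -> Hom (coprod A B) D;
  copair1 : forall (A B D : C) (f : Hom A D) (g : Hom B D),
      copair f g ∘ inj1 A B = f;
  copair2 : forall (A B D : C) (f : Hom A D) (g : Hom B D),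
      copair f g ∘ inj2 A B = g;
  copair_unique : forall (A B D : C) (h k : Hom (coprod A B) D),
      h ∘ inj1 A B = k ∘ inj1 A B -> h ∘ inj2 A B = k ∘ inj2 A B -> h = k
}.

Arguments copair {C} _ {A B D} _ _.

Record Monad (C : Category) := MkMonad {
  endo :> Functor C C;
  eta : NatTrans (functor_id C) endo;
  mu : NatTrans (functor_comp endo endo) endo;
  mu_eta_l : forall A : C, mu A ∘ eta (endo A) = idm (endo A);
  mu_eta_r : forall A : C, mu A ∘ fmap endo (eta A) = idm (endo A);
  mu_assoc : forall A : C,
      mu A ∘ mu (endo A) = mu A ∘ fmap endo (mu A)
}.

Definition essentially_nullary (C : Category) (S : FiniteCoproducts C)
    (T : Monad C) : Prop :=
  forall A : C,
    is_strong_epi (copair S (fmap T (from_initial S A)) (eta T A)).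

(* Main.v *)
Require Import Defs.

(** Write [0] for the zero object and [t : A -> 0] for the unique morphism.
    Applied to [t], cartesianness of [eta] says that [eta_A] is the pullback of
    [eta_0 : 0 -> T 0] along [T t : T A -> T 0], that is, the kernel of [T t].
    As [T t] is split by [T !_A], the morphisms [T !_A] and [eta_A] are the
    section and the kernel of a point over [T 0].  In a protomodular category
    these are jointly extremal ([section_and_fibre_jointly_extremal]): a
    subobject of the point containing both has the same fibre, so it is
    everything.  Hence the copairing is an extremal epimorphism, and in the
    presence of finite limits extremal epimorphisms are strong
    ([extremal_strong_epi]). *)

Set Implicit Arguments.
Unset Strict Implicit.

Local Open Scope cat_scope.

Definition extremal (C : Category) (A B : C) (e : Hom A B) : Prop :=
  forall (M : C) (m : Hom M B) (a : Hom A M),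
    is_mono m -> m ∘ a = e -> is_iso m.

Lemma pb1_mono (C : Category) (A B D : C) (f : Hom A D) (g : Hom B D)
    (P : Pullback f g) : is_mono g -> is_mono (pb1 P).
Proof.
  intros hg W h k e. apply (pb_unique (p := P)); [exact e|].
  apply hg. rewrite !comp_assoc, <- !(pb_comm P), <- !comp_assoc.
  now rewrite e.
Qed.

(** The equalizer of [u] and [v] is the pullback of the diagonal of [Z] along
    [(u, v)], the product [Z * Z] being a pullback over the terminal object. *)
Lemma equalizer_exists (C : Category) (PB : Pullbacks C) (I : C)
    (hI : is_terminal I) (B Z : C) (u v : Hom B Z) :
  exists (M : C) (m : Hom M B),
    is_mono m /\ u ∘ m = v ∘ m /\
    forall (A : C) (e : Hom A B), u ∘ e = v ∘ e ->
      exists a : Hom A M, m ∘ a = e.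
Proof.
  destruct (hI Z) as [t _].
  assert (ht : forall (W : C) (a b : Hom W I), a = b).
  { intros W a b. destruct (hI W) as [c [_ hc]].
    rewrite <- (hc a Logic.I). exact (hc b Logic.I). }
  set (ZZ := PB _ _ _ t t).
  set (uv := pb_lift ZZ (ht _ (t ∘ u) (t ∘ v))).
  set (diag := pb_lift ZZ (eq_refl (t ∘ idm Z))).
  set (E := PB _ _ _ uv diag).
  assert (u1 : pb1 ZZ ∘ uv = u) by apply pb_lift1.
  assert (u2 : pb2 ZZ ∘ uv = v) by apply pb_lift2.
  assert (d1 : pb1 ZZ ∘ diag = idm Z) by apply pb_lift1.
  assert (d2 : pb2 ZZ ∘ diag = idm Z) by apply pb_lift2.
  exists (apex E), (pb1 E). split; [|split].
  - apply pb1_mono. intros W h k e.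
    rewrite <- (comp_idl h), <- (comp_idl k), <- d1, <- !comp_assoc.
    now rewrite e.
  - rewrite <- u1, <- u2, <- !comp_assoc, (pb_comm E), !comp_assoc.
    now rewrite d1, d2.
  - intros A e he.
    assert (c : uv ∘ e = diag ∘ (u ∘ e)).
    { apply (pb_unique (p := ZZ)); rewrite !comp_assoc.
      - now rewrite u1, d1, comp_idl.
      - now rewrite u2, d2, comp_idl. }
    exists (pb_lift E c). apply pb_lift1.
Qed.

(** Extremality is applied to two subobjects of [B]: an equalizer of two
    morphisms that agree on [e], which gives that [e] is epic, and the
    pullback of a monomorphism [m] along the bottom of a square from [e] to
    [m], which gives the diagonal. *)
Lemma extremal_strong_epi (C : Category) (PB : Pullbacks C) (I : C)
    (hI : is_terminal I) (A B : C) (e : Hom A B) :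
  extremal e -> is_strong_epi e.
Proof.
  intros he. split.
  - intros Z u v h.
    destruct (equalizer_exists PB hI u v) as [M [m [hm [huv hfac]]]].
    destruct (hfac A e h) as [a ha].
    destruct (he M m a hm ha) as [n [_ hmn]].
    rewrite <- (comp_idr u), <- (comp_idr v), <- hmn, !comp_assoc.
    now rewrite huv.
  - intros U V m hm u v h.
    set (P := PB _ _ _ v m).
    destruct (he _ (pb1 P) (pb_lift P (eq_sym h)) (pb1_mono (P := P) hm)
                (pb_lift1 P (eq_sym h))) as [n [_ hn]].
    assert (hd : m ∘ (pb2 P ∘ n) = v).
    { rewrite comp_assoc, <- (pb_comm P), <- comp_assoc, hn.
      apply comp_idr. }
    exists (pb2 P ∘ n). split.
    + split; [|exact hd].
      apply hm. now rewrite comp_assoc, hd.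
    + intros d [_ hd']. apply hm. now rewrite hd, hd'.
Qed.

Lemma point_iso (C : Category) (B : C) (P Q : Point B) (f : PointHom P Q) :
  is_iso (pt_map f) -> @is_iso (Pt B) P Q f.
Proof.
  intros [g [gf fg]].
  assert (gp : pt_proj P ∘ g = pt_proj Q).
  { rewrite <- (pt_map_proj f), <- comp_assoc, fg. apply comp_idr. }
  assert (gs : g ∘ pt_sect Q = pt_sect P).
  { rewrite <- (pt_map_sect f), comp_assoc, gf. apply comp_idl. }
  exists (MkPointHom gp gs). split; apply PointHom_eq; assumption.
Qed.

(** A subobject [m] through which the section factors is itself a point, and
    [m] is then a morphism of points.  Pulling [m] back along [v] gives a
    monomorphism, which is split epic as soon as the fibre [k] factors
    through [m]; so it is an isomorphism, and protomodularity applies. *)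
Lemma section_and_fibre_jointly_extremal (C : Category) (PB : Pullbacks C)
    (hproto : protomodular PB) (B' B K : C) (P : Point B) (v : Hom B' B)
    (q : Hom K B') (k : Hom K (pt_obj P))
    (hk : is_pullback v (pt_proj P) q k)
    (M : C) (m : Hom M (pt_obj P)) (hm : is_mono m)
    (s : Hom B M) (hs : m ∘ s = pt_sect P)
    (c : Hom K M) (hc : m ∘ c = k) : is_iso m.
Proof.
  assert (hsplit : (pt_proj P ∘ m) ∘ s = idm B).
  { rewrite <- comp_assoc, hs. apply pt_split. }
  set (Q := MkPoint hsplit).
  set (f := @MkPointHom C B Q P m eq_refl hs).
  enough (hf : @is_iso (Pt B) Q P f).
  { destruct hf as [g [gf fg]]. exists (pt_map g).
    split; [exact (f_equal (@pt_map _ _ _ _) gf)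
           |exact (f_equal (@pt_map _ _ _ _) fg)]. }
  apply (hproto _ _ v). apply point_iso. simpl.
  set (FP := PB _ _ _ v (pt_proj P)).
  set (FQ := PB _ _ _ v (pt_proj P ∘ m)).
  set (w := pb_lift FP _).
  assert (w1 : pb1 FP ∘ w = pb1 FQ) by apply pb_lift1.
  assert (w2 : pb2 FP ∘ w = m ∘ pb2 FQ) by apply pb_lift2.
  destruct (proj2 hk _ (pb1 FP) (pb2 FP) (pb_comm FP)) as [h [[_ hh] _]].
  assert (mch : m ∘ (c ∘ h) = pb2 FP) by now rewrite comp_assoc, hc.
  assert (comm : v ∘ pb1 FP = (pt_proj P ∘ m) ∘ (c ∘ h)).
  { rewrite <- comp_assoc, mch. apply pb_comm. }
  set (n := pb_lift FQ comm).
  assert (n1 : pb1 FQ ∘ n = pb1 FP) by apply pb_lift1.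
  assert (n2 : pb2 FQ ∘ n = c ∘ h) by apply pb_lift2.
  exists n. split.
  - apply (pb_unique (p := FQ)).
    + now rewrite comp_assoc, n1, w1, comp_idr.
    + apply hm. rewrite comp_idr, (comp_assoc (pb2 FQ)), n2.
      now rewrite comp_assoc, mch, w2.
  - apply (pb_unique (p := FP)).
    + now rewrite comp_assoc, w1, n1, comp_idr.
    + now rewrite comp_assoc, w2, <- comp_assoc, n2, mch, comp_idr.
Qed.

(** Any two initial objects are isomorphic, so the chosen one is a retract of
    the zero object, and a retract of a terminal object is terminal. *)
Lemma pointed_initial_terminal (C : Category) (S : FiniteCoproducts C) :
  pointed C -> is_terminal (initial S).
Proof.
  intros [Z [hi ht]] A.
  destruct (hi (initial S)) as [j _].
  set (i := from_initial S Z).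
  assert (ji : j ∘ i = idm (initial S)).
  { now rewrite (from_initial_unique (j ∘ i)), (from_initial_unique (idm _)). }
  destruct (ht A) as [a [_ ha]].
  exists (j ∘ a). split; [exact Logic.I|].
  intros f _. rewrite (ha (i ∘ f) Logic.I), comp_assoc, ji. apply comp_idl.
Qed.

Theorem theorem2p3 (X : Category) (PB : Pullbacks X) (S : FiniteCoproducts X)
    (T : Monad X) (hpointed : pointed X) (hproto : protomodular PB)
    (hunit : cartesian (eta T)) : essentially_nullary S T.
Proof.
  intros A.
  pose proof (pointed_initial_terminal S hpointed) as hI.
  apply (extremal_strong_epi PB hI).
  intros M m a hm ha.
  destruct (hI A) as [t _].
  assert (hsplit : fmap T t ∘ fmap T (from_initial S A)
                   = idm (T (initial S))).
  { rewrite <- fmap_comp, <- fmap_id. f_equal.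
    now rewrite (from_initial_unique (t ∘ _)), (from_initial_unique (idm _)). }
  assert (hs : m ∘ (a ∘ inj1 S _ _) = fmap T (from_initial S A)).
  { rewrite comp_assoc, ha. apply copair1. }
  assert (hc : m ∘ (a ∘ inj2 S _ A) = eta T A).
  { rewrite comp_assoc, ha. apply copair2. }
  exact (section_and_fibre_jointly_extremal (P := MkPoint hsplit) hproto
           (hunit A (initial S) t) hm hs hc).
Qed.
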